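(* Let $1\le p<\infty$. If $A\in(l_1(r,s,t;B),l_p)$, then $$\|L_A\|_\chi=\lim_{m\to\infty}\Big(\sup_k\Big(\sum_{n=m+1}^\infty|\tilde a_{nk}|^p\Big)^{1/p}\Big).$$
   Context: Sequences are indexed by $\mathbb{N}_0=\{0,1,2,\dots\}$; $w$ is the space of all real or complex sequences. $r=(r_n)$, $t=(t_n)$, $s=(s_n)$ are sequences in $w$ with $r_n\ne0$, $t_n\neq 0$ for all $n$, and $s_0\neq0$; $u,v$ are nonzero scalars. $A(r,s,t)$ is the lower triangular infinite matrix with entries $s_{n-k}t_k/r_n$ for $0\le k\le n$ and $0$ for $k>n$; $B=B(u,v)=(b_{nk})$ has $b_{nn}=u$, $b_{n,n-1}=v$ and all other entries $0$. $l_1(r,s,t;B)=\{x\in w:(A(r,s,t)\cdot B)x\in l_1\}$ with norm $\|x\|=\|(A(r,s,t)\cdot B)x\|_{l_1}$ (a $BK$ space, i.e. a Banach sequence space with continuous coordinates). $D^{(s)}_0=1/s_0$ and, for $n\ge1$, $D^{(s)}_n=s_0^{-(n+1)}\det(d_{ij})_{1\le i,j\le n}$ with $d_{ij}=s_{i-j+1}$ if $j\le i+1$ and $d_{ij}=0$ if $j>i+1$. For sequence spaces $U,V$, $(U,V)$ is the class of infinite matrices $A=(a_{nk})$ such that for all $x\in U$ the series $(Ax)_n=\sum_ka_{nk}x_k$ converge and $Ax\in V$. $L_A$ is the operator $L_A(x)=Ax$ (bounded when $U,V$ are $BK$ spaces with $U$ containing all finite sequences). For a matrix $A=(a_{nk})$,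 $$\tilde a_{nk}=r_k\Big[\frac{a_{nk}}{s_0t_k}\frac1u+\sum_{i=k}^{k+1}(-1)^{i-k}\frac{D^{(s)}_{i-k}}{t_i}\Big(\sum_{j=k+1}^\infty\frac{(-v)^{j-i}}{u^{j-i+1}}a_{nj}\Big)+\sum_{i=k+2}^\infty(-1)^{i-k}\frac{D^{(s)}_{i-k}}{t_i}\Big(\sum_{j=i}^\infty\frac{(-v)^{j-i}}{u^{j-i+1}}a_{nj}\Big)\Big],$$ provided the series converge. The Hausdorff measure of noncompactness of a bounded subset $Q$ of a metric space $X$ is $\chi(Q)=\inf\{\epsilon>0: Q\subset\bigcup_{i=0}^nB(x_i,r_i),\ x_i\in X,\ r_i<\epsilon,\ n\in\mathbb{N}_0\}$, where $B(x_i,r_i)$ are open balls. For a bounded operator $L:X\to Y$ between Banach spaces, $\|L\|_\chi=\chi(L(S_X))$ with $S_X$ the unit sphere of $X$.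
   Formalization: ''Provided the series converge'' is read, for all n and k, as: each inner series over j converges and the double series over i≥k+2, j≥i converges in Pringsheim's sense; with convergence of the iterated series alone the formula can fail. *)

(* Defs.v *)
From HB Require Import structures.
From mathcomp Require Import all_boot all_order all_algebra.
From mathcomp Require Import all_classical all_reals all_analysis.
From mathcomp Require Import complex.

Set Implicit Arguments.
Unset Strict Implicit.
Unset Printing Implicit Defensive.

Import Order.TTheory GRing.Theory Num.Theory.
Import numFieldNormedType.Exports.

Local Open Scope classical_set_scope.
Local Open Scope ring_scope.

Local Notation "\sum_ ( m <= i <oo ) F" :=
  (\big[+%R/0%R]_(m <= i <oo) F%R) : ring_scope.

(* The scalar field K is either R or R[i].  Since the norm `|x| of a
   numFieldType K is K-valued, K comes with its R-valued modulus. *)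
Variant real_or_complex (R : realType) : forall K : numFieldType, (K -> R) -> Prop :=
| RealScalars : @real_or_complex R R (fun x => `|x|)
| ComplexScalars :
    @real_or_complex R (R[i] : numFieldType) (@ComplexField.Normc.normc R).

Section Matrices.
Variable K : numFieldType.
Implicit Types (A B : nat -> nat -> K) (x r s t : nat -> K).

Definition mx_app A x : nat -> K := fun n => \sum_(0 <= k <oo) A n k * x k.

Definition mx_app_defined A x : Prop :=
  forall n, cvgn (series (fun k => A n k * x k)).

Definition mx_mul A B : nat -> nat -> K :=
  fun n k => \sum_(0 <= j <oo) A n j * B j k.

Definition mx_class (U V : set (nat -> K)) : set (nat -> nat -> K) :=
  [set A | forall x, U x -> mx_app_defined A x /\ V (mx_app A x)].

Definition genmean_mx r s t : nat -> nat -> K :=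
  fun n k => if (k <= n)%N then s (n - k)%N * t k / r n else 0.

Definition diff_mx (u v : K) : nat -> nat -> K :=
  fun n k => if k == n then u else if n == k.+1 then v else 0.

(* Entries are numbered from 0, which leaves the differences of indices
   unchanged.  For n = 0 the determinant is empty and the value is 1 / s 0. *)
Definition Dseq s (n : nat) : K :=
  (s 0%N) ^- n.+1 *
  \det (\matrix_(i < n, j < n) if (j <= i.+1)%N then s (i.+1 - j)%N else 0).

Section Atilde.
Variables (r s t : nat -> K) (u v : K) (A : nat -> nat -> K).

Definition atilde_coef (k i : nat) : K :=
  (-1) ^+ (i - k) * (Dseq s (i - k) / t i).

(* only used for i <= j *)
Definition atilde_term (n i j : nat) : K :=
  (- v) ^+ (j - i) / u ^+ (j - i).+1 * A n j.

Definition atilde (n k : nat) : K :=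
  r k * (A n k / (s 0%N * t k) * u^-1
         + \sum_(k <= i < k.+2) atilde_coef k i *
             (\sum_(k.+1 <= j <oo) atilde_term n i j)
         + \sum_(k.+2 <= i <oo) atilde_coef k i *
             (\sum_(i <= j <oo) atilde_term n i j)).

(* Convergence of the series in [atilde n k]: every single series over j
   converges, and the double series over i >= k + 2, j >= i converges in the
   sense of Pringsheim, i.e. its rectangular partial sums have a limit when
   both bounds tend to infinity independently.  The outer series over i then
   converges to that limit.  Convergence of the iterated series alone would
   not force [atilde n k] to be the value of the n-th row of A on the k-th
   basis vector of the domain. *)
Definition atilde_cvg (n k : nat) : Prop :=
  [/\ forall i, (k <= i < k.+2)%N ->
        cvgn (fun J => \sum_(k.+1 <= j < J) atilde_term n i j),
      forall i, (k.+2 <= i)%N ->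
        cvgn (fun J => \sum_(i <= j < J) atilde_term n i j)
    & cvg ((fun N : nat * nat => \sum_(k.+2 <= i < N.1) atilde_coef k i *
              (\sum_(i <= j < N.2) atilde_term n i j))
           @ filter_prod \oo \oo)].

End Atilde.
End Matrices.

Section Spaces.
Variables (R : realType) (K : numFieldType) (nrm : K -> R).

Definition lp_norm (p : R) (x : nat -> K) : \bar R :=
  ((\sum_(0 <= n <oo) (nrm (x n) `^ p)%:E) `^ p^-1)%E.

Definition lp_space (p : R) : set (nat -> K) :=
  [set x | (\sum_(0 <= n <oo) (nrm (x n) `^ p)%:E < +oo)%E].

Definition lp_dist (p : R) (x y : nat -> K) : \bar R :=
  lp_norm p (fun n => x n - y n).

Definition mx_domain (T : nat -> nat -> K) (U : set (nat -> K)) :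
    set (nat -> K) :=
  [set x | mx_app_defined T x /\ U (mx_app T x)].

Definition genmean_diff_mx (r s t : nat -> K) (u v : K) : nat -> nat -> K :=
  mx_mul (genmean_mx r s t) (diff_mx u v).

Definition l1rst (r s t : nat -> K) (u v : K) : set (nat -> K) :=
  mx_domain (genmean_diff_mx r s t u v) (lp_space 1).

Definition l1rst_norm (r s t : nat -> K) (u v : K) (x : nat -> K) : \bar R :=
  lp_norm 1 (mx_app (genmean_diff_mx r s t u v) x).

Definition l1rst_sphere (r s t : nat -> K) (u v : K) : set (nat -> K) :=
  [set x | l1rst r s t u v x /\ l1rst_norm r s t u v x = 1%:E].

End Spaces.

(* The metric space is the set X with the distance d; d is extended-real
   valued only because it is also defined outside X. *)
Definition hausdorff_mnc (R : realType) (T : Type) (X : set T)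
    (d : T -> T -> \bar R) (Q : set T) : \bar R :=
  ereal_inf [set eps%:E | eps in [set eps : R | 0 < eps /\
    exists (n : nat) (c : 'I_n.+1 -> T) (rad : 'I_n.+1 -> R),
      (forall i, X (c i) /\ rad i < eps) /\
      Q `<=` \bigcup_i [set y | X y /\ (d (c i) y < (rad i)%:E)%E]]].

(* Only unit sphere, codomain and distance of the codomain enter. *)
Definition op_mnc (R : realType) (T1 T2 : Type) (S : set T1) (Y : set T2)
    (d : T2 -> T2 -> \bar R) (L : T1 -> T2) : \bar R :=
  hausdorff_mnc Y d (L @` S).

(* Main.v *)
Require Import Defs.
From HB Require Import structures.
From mathcomp Require Import all_boot all_order all_algebra.
From mathcomp Require Import all_classical all_reals all_analysis.
From mathcomp Require Import complex ring lra zify.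

Set Implicit Arguments.
Unset Strict Implicit.
Unset Printing Implicit Defensive.

Import Order.TTheory GRing.Theory Num.Theory.
Import numFieldNormedType.Exports.

Local Open Scope classical_set_scope.
Local Open Scope ring_scope.

(** Write T for the triangle A(r,s,t) B.  It has a two-sided inverse, whose k-th
    column is [invcol k], so x = sum_k y_k (invcol k) with y = T x, and T
    carries the unit sphere of l_1(r,s,t;B) onto that of l_1.  The vectors
    [invcol k] lie on the sphere and A maps them to the columns of the matrix
    atilde ([mx_app_invcol]).

    The measure of noncompactness of a nonempty, coordinatewise bounded set Q
    in l_p is the limit of sup_(z in Q) ||tail_m z||_p ([hausdorff_mnc_lp]): the
    first m coordinates range over a totally bounded set, hence cost nothing,
    and conversely the finitely many centres of a covering have small tails.
    Take Q to be the image of the sphere.  A tail of A x is the limit of the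
    combinations sum_(k < N) y_k (tail of the k-th column of atilde), whose
    coefficients have total modulus at most 1; so the supremum over Q is the
    supremum over the columns ([image_sup_tail]).

    Two points need work.  The formula for atilde involves the determinants
    D_n, which are identified with the coefficients of the inverse of the
    triangular Toeplitz matrix of s through its adjugate ([Dseq_conv]).  And
    (A x)_n = sum_k y_k atilde_nk means that the n-th row of A, which is only
    known to define convergent series, acts continuously on l_1(r,s,t;B);
    this is an instance of the uniform boundedness principle, obtained by a
    gliding hump ([gliding_hump]). *)

(** * Real and complex scalars *)

(** What the two scalar fields have in common.  The norm of K has its values in
    K, so [emb] is needed to compare it with the R-valued modulus.  Total
    boundedness of discs, which depends on the dimension of K over R, is what
    makes bounded sets of heads of sequences totally bounded. *)
Record modulus (R : realType) (K : numFieldType) (nrm : K -> R)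
    (emb : {rmorphism R -> K}) : Prop := Modulus {
  normE : forall x, `|x| = emb (nrm x);
  emb_le : {mono emb : a b / a <= b};
  finite_net : forall M e : R, 0 < e -> exists l : seq K,
    forall x, nrm x <= M -> exists2 c, c \in l & nrm (x - c) <= e }.

(** The net is the arithmetic progression of step e starting at -M. *)
Lemma finite_net_real (R : realType) (M e : R) : 0 < e -> exists l : seq R,
  forall x, `|x| <= M -> exists2 c, c \in l & `|x - c| <= e.
Proof.
move=> e0.
pose g (i : nat) : R := e * i%:R - M.
exists [seq g i | i <- iota 0 (Num.truncn (2 * M / e)).+1] => x.
rewrite ler_norml => /andP[Mx xM].
have y0 : 0 <= (x + M) / e by rewrite divr_ge0 ?(ltW e0)//; lra.
have /andP[ty yt] := truncn_itv y0.
set i := Num.truncn _ in ty yt.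
exists (g i).
  apply: map_f; rewrite mem_iota /= add0n ltnS.
  by apply: le_truncn; rewrite ler_pM2r ?invr_gt0//; lra.
move: ty yt; rewrite ler_pdivlMr// ltr_pdivrMr// -natr1 /g => ty yt.
rewrite ler_norml; apply/andP; split; lra.
Qed.

Lemma real_or_complex_modulus (R : realType) (K : numFieldType) (nrm : K -> R) :
  real_or_complex nrm -> exists emb : {rmorphism R -> K}, modulus nrm emb.
Proof.
case.
  exists (idfun : {rmorphism R -> R}); split => //.
  exact: finite_net_real.
exists (real_complex R : {rmorphism R -> R[i]}); split.
- by case.
- by move=> a b; rewrite lecR.
move=> M e e0.
have [l hl] := @finite_net_real R M (e / 2) (divr_gt0 e0 (ltr0Sn R 1)).
exists [seq (a +i* b)%C | a <- l, b <- l] => -[a b] /= nM.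
have aM : `|a| <= M.
  by rewrite (le_trans _ nM)// -sqrtr_sqr ler_wsqrtr// lerDl sqr_ge0.
have bM : `|b| <= M.
  by rewrite (le_trans _ nM)// -sqrtr_sqr ler_wsqrtr// lerDr sqr_ge0.
have [c cl ac] := hl _ aM; have [d dl bd] := hl _ bM.
exists (c +i* d)%C; first by apply/allpairsP; exists (c, d).
rewrite -[leRHS]ger0_norm ?(ltW e0)// -sqrtr_sqr /= ler_wsqrtr//.
rewrite -(real_normK (num_real (a - c))) -(real_normK (num_real (b - d))).
have := normr_ge0 (a - c); have := normr_ge0 (b - d); nra.
Qed.

Section ModulusTheory.
Context (R : realType) (K : numFieldType) (nrm : K -> R).
Context (emb : {rmorphism R -> K}) (mod : modulus nrm emb).

Let emb_lt : {mono emb : a b / a < b}.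
Proof. exact: leW_mono (emb_le mod). Qed.

Lemma nrm_ge0 x : 0 <= nrm x.
Proof. by rewrite -(emb_le mod) rmorph0 -(normE mod). Qed.

Lemma nrm0 : nrm 0 = 0.
Proof. by apply: (fmorph_inj emb); rewrite -(normE mod) normr0 rmorph0. Qed.

Lemma nrmM x y : nrm (x * y) = nrm x * nrm y.
Proof. by apply: (fmorph_inj emb); rewrite rmorphM -!(normE mod) normrM. Qed.

Lemma nrmN x : nrm (- x) = nrm x.
Proof. by apply: (fmorph_inj emb); rewrite -!(normE mod) normrN. Qed.

Lemma nrmB x y : nrm (x - y) = nrm (y - x).
Proof. by rewrite -nrmN opprB. Qed.

Lemma nrmD x y : nrm (x + y) <= nrm x + nrm y.
Proof. by rewrite -(emb_le mod) rmorphD -!(normE mod) ler_normD. Qed.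

Lemma nrm_emb a : nrm (emb a) = `|a|.
Proof.
apply: (fmorph_inj emb); rewrite -(normE mod).
have [a0|a0] := leP 0 a.
  have ea : 0 <= emb a by rewrite -(rmorph0 emb) (emb_le mod).
  by rewrite !ger0_norm.
have ea : emb a < 0 by rewrite -(rmorph0 emb) emb_lt.
by rewrite !ltr0_norm// rmorphN.
Qed.

Lemma nrm1 : nrm 1 = 1.
Proof. by rewrite -(rmorph1 emb) nrm_emb normr1. Qed.

Lemma nrm_sum (I : Type) (l : seq I) (P : pred I) (f : I -> K) :
  nrm (\sum_(i <- l | P i) f i) <= \sum_(i <- l | P i) nrm (f i).
Proof.
elim/big_ind2: _ => [|x a y b xa yb|//]; first by rewrite nrm0.
by rewrite (le_trans (nrmD _ _))// lerD.
Qed.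

(** The topology of K is given by balls with radii in K; positive elements of K
    are their own norm, hence images under [emb], so radii in R suffice. *)
Lemma cvg_nrmP (T : Type) (F : set_system T) (FF : Filter F) (f : T -> K) l :
  f @ F --> l <-> forall e : R, 0 < e -> \forall x \near F, nrm (l - f x) < e.
Proof.
split => [/cvgrPdist_lt fl e e0|fl].
  have : 0 < emb e by rewrite -(rmorph0 emb) emb_lt.
  by move=> /fl; apply: filterS => x; rewrite (normE mod) emb_lt.
apply/cvgrPdist_lt => e e0.
move: (e0); rewrite -[e]gtr0_norm// (normE mod) -(rmorph0 emb) emb_lt.
by move=> /fl; apply: filterS => x; rewrite (normE mod) emb_lt.
Qed.

Lemma cvg_nrm (T : Type) (F : set_system T) (FF : Filter F) (f : T -> K) l :
  f @ F --> l -> (nrm \o f) @ F --> nrm l.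
Proof.
move=> /cvg_nrmP fl; apply/cvgrPdist_lt => e /fl.
apply: filterS => x; apply: le_lt_trans.
rewrite ler_norml /=; apply/andP; split.
  have := nrmD (f x - l) l; rewrite subrK nrmB; lra.
have := nrmD (l - f x) (f x); rewrite subrK; lra.
Qed.

End ModulusTheory.

(** * The triangle A(r,s,t) B and its inverse *)

Section Triangles.
Context (K : numFieldType).
Implicit Types (f x y z : nat -> K).

Lemma exchange_triangle (F : nat -> nat -> K) m n :
  \sum_(m <= j < n) \sum_(m <= i < j.+1) F i j =
  \sum_(m <= i < n) \sum_(i <= j < n) F i j.
Proof.
elim: n => [|n IH]; first by rewrite !big_geq.
have [nm|mn] := ltnP n m; first by rewrite !big_geq.
rewrite big_nat_recr//= IH [in RHS]big_nat_recr//= big_nat1.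
rewrite big_nat_recr//= addrA; congr (_ + _).
rewrite -big_split/=; apply: eq_big_nat => i /andP[_ ni].
by rewrite [in RHS]big_nat_recr// ltnW.
Qed.

Lemma cvg_series_eventually0 f N : (forall k, (N <= k)%N -> f k = 0) ->
  series f @ \oo --> \sum_(0 <= k < N) f k.
Proof.
move=> f0; apply: cvg_near_cst; near=> n.
have Nn : (N <= n)%N by near: n; exists N.
rewrite /series/= (big_cat_nat (n := N))//= [X in _ + X]big_nat_cond.
by rewrite [X in _ + X]big1 ?addr0// => i /andP[/andP[/f0]].
Unshelve. all: by end_near. Qed.

Lemma lim_series_eventually0 f N : (forall k, (N <= k)%N -> f k = 0) ->
  limn (fun n => \sum_(0 <= k < n) f k) = \sum_(0 <= k < N) f k.
Proof. by move=> /cvg_series_eventually0/cvg_lim; apply. Qed.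

Context (s : nat -> K) (hs : s 0%N != 0).

(** The numbers (-1)^l D_l are the coefficients of the inverse of the formal
    power series of s.  Proof by induction on m: let L be the lower triangular
    Toeplitz matrix of s of size m + 1 and d the column of the (-1)^l D_l.  By
    induction L d is the first basis vector plus an unknown multiple W of the
    last one.  Multiplying by the adjugate gives (det L) d_m as a cofactor, whose
    minor is the Hessenberg determinant in D_m, plus s_0^m W; the two
    evaluations agree only if W = 0. *)
Lemma Dseq_conv m :
  \sum_(0 <= l < m.+1) s (m - l)%N * ((-1) ^+ l * Dseq s l) = (m == 0%N)%:R.
Proof.
pose d l := (-1) ^+ l * Dseq s l.
pose W i := \sum_(0 <= l < i.+1) s (i - l)%N * d l.
rewrite -[LHS]/(W m); elim/ltn_ind: m => -[_|m IH].
  rewrite /W big_nat1 subnn /d /Dseq det_mx00 expr0 expr1 mul1r mulr1.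
  by rewrite mulfV.
pose L q : 'M[K]_q := \matrix_(i, j) if (j <= i)%N then s (i - j)%N else 0.
have detL q : \det (L q) = s 0%N ^+ q.
  rewrite det_trig; last first.
    by apply/is_trig_mxP => i j ij; rewrite mxE leqNgt ij.
  rewrite -[in RHS](card_ord q) -prodr_const; apply: eq_bigr => i _.
  by rewrite mxE leqnn subnn.
pose dv : 'cV[K]_m.+2 := \col_i d i.
have Ldv : L m.+2 *m dv = \col_i W i.
  apply/matrixP => i j; rewrite !mxE /W big_mkord.
  rewrite (big_ord_widen m.+2 (fun l => s (i - l)%N * d l)) ?ltn_ord//.
  rewrite [RHS]big_mkcond; apply: eq_bigr => l _ /=.
  by rewrite !mxE ltnS; case: ifP => // _; rewrite mul0r.
have := congr1 (fun M : 'cV_m.+2 => M ord_max ord0)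
  (mulmxA (\adj (L m.+2)) (L m.+2) dv).
rewrite Ldv mul_adj_mx mul_scalar_mx detL !mxE /= big_ord_recl big_ord_recr /=.
rewrite !mxE big1 => [|i _]; last first.
  by rewrite !mxE lift0 IH ?mulr0//= ltnS ltn_ord.
rewrite IH// mulr1 add0r => E.
(* deleting row 0 and the last column of L leaves the matrix of D_m *)
have E1 : cofactor (L m.+2) ord0 ord_max = s 0%N ^+ m.+2 * d m.+1.
  rewrite /cofactor /d /Dseq mulrCA; congr (_ * _).
  rewrite mulrA mulfV ?expf_neq0// mul1r; congr (\det _).
  apply/matrixP => i j; rewrite !mxE lift0 lift_max.
  by [].
have E2 : cofactor (L m.+2) ord_max ord_max = s 0%N ^+ m.+1.
  rewrite /cofactor -signr_odd addnn odd_double expr0 mul1r -detL.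
  by congr (\det _); apply/matrixP => i j; rewrite !mxE !lift_max.
move: E; rewrite E1 (_ : lift ord0 ord_max = ord_max :> 'I_m.+2); last first.
  by apply/val_inj; rewrite /= /bump leq0n add1n.
rewrite E2 /= => /(canRL (addKr _)); rewrite addNr => /eqP.
by rewrite mulf_eq0 (negPf (expf_neq0 _ hs)) /= => /eqP.
Qed.

Context (r t : nat -> K) (u v : K).
Context (hr : forall n, r n != 0) (ht : forall n, t n != 0) (hu : u != 0).

Local Notation T := (genmean_diff_mx r s t u v).

Definition shift x k := if k is k'.+1 then x k' else 0.

Let Tterm n x k := s (n - k)%N * t k / r n * (u * x k + v * shift x k).

Lemma genmean_diff_mx_gt n k : (n < k)%N -> T n k = 0.
Proof.
move=> nk; rewrite /genmean_diff_mx /mx_mul (@lim_series_eventually0 _ n.+1).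
  rewrite big_nat_cond big1// => j /andP[/andP[_ jn] _].
  rewrite /diff_mx ifF; last by apply/eqP; lia.
  by rewrite ifF ?mulr0//; apply/eqP; lia.
by move=> j nj; rewrite /genmean_mx leqNgt nj/= mul0r.
Qed.

Lemma mx_app_genmean_defined x : mx_app_defined T x.
Proof.
move=> n; apply/cvg_ex; eexists; apply: (@cvg_series_eventually0 _ n.+1) => k nk.
by rewrite genmean_diff_mx_gt ?mul0r.
Qed.

Lemma mx_app_genmean x n :
  mx_app T x n = \sum_(0 <= k < n.+1) Tterm n x k.
Proof.
rewrite /mx_app (@lim_series_eventually0 _ n.+1); last first.
  by move=> k nk; rewrite genmean_diff_mx_gt ?mul0r.
have TE k : T n k = \sum_(0 <= j < n.+1) genmean_mx r s t n j * diff_mx u v j k.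
  rewrite /genmean_diff_mx /mx_mul (@lim_series_eventually0 _ n.+1)//.
  by move=> j nj; rewrite /genmean_mx leqNgt nj/= mul0r.
under eq_bigr do rewrite TE mulr_suml.
rewrite exchange_big_nat/=; apply: eq_big_nat => j /andP[_ jn].
under eq_bigr do rewrite -mulrA.
rewrite -mulr_sumr /genmean_mx -ltnS jn /Tterm; congr (_ * _).
have -> : \sum_(0 <= k < n.+1) diff_mx u v j k * x k =
    \sum_(0 <= k < j.+1) diff_mx u v j k * x k.
  rewrite (big_cat_nat (n := j.+1))//= [X in _ + X]big_nat_cond.
  rewrite [X in _ + X]big1 ?addr0// => k /andP[/andP[jk _] _].
  rewrite /diff_mx ifF; last by apply/eqP; lia.
  by rewrite ifF ?mul0r//; apply/eqP; lia.
rewrite big_nat_recr//= /diff_mx eqxx addrC; congr (_ + _).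
case: j {jn} => [|j]; first by rewrite big_geq// mulr0.
rewrite big_nat_recr//= big_nat_cond big1; last first.
  move=> k /andP[/andP[_ kj] _]; rewrite ifF; last by apply/eqP; lia.
  by rewrite ifF ?mul0r//; apply/eqP; lia.
by rewrite add0r ifF ?eqxx//; apply/eqP; lia.
Qed.

(** On the diagonal T has the nonzero entries s_0 t_n u / r_n, so the coordinates
    of x can be recovered one after the other. *)
Lemma mx_app_genmean_inj x y : mx_app T x =1 mx_app T y -> x =1 y.
Proof.
move=> Txy n; elim/ltn_ind: n => n IH.
have := Txy n; rewrite !mx_app_genmean !big_nat_recr//=.
have sxy k : (k <= n)%N -> shift x k = shift y k.
  by case: k => // k kn; rewrite /= IH.
rewrite (@eq_big_nat _ _ _ _ _ _ (Tterm n y)) => [|k /andP[_ kn]]; last first.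
  by rewrite /Tterm IH// sxy// ltnW.
move=> /addrI; rewrite /Tterm sxy// subnn => /mulfI.
rewrite !mulf_neq0 ?invr_neq0// => /(_ isT)/addIr.
exact: mulfI.
Qed.

(** The inverse of T is the product of the inverse of B, with entries
    (-v)^(j-i) / u^(j-i+1), and that of A(r,s,t), with entries
    r_k [atilde_coef k i]. *)
Definition invcol (k j : nat) : K :=
  r k * \sum_(k <= i < j.+1)
    (- v) ^+ (j - i) / u ^+ (j - i).+1 * atilde_coef s t k i.

Definition invapp y (j : nat) : K := \sum_(0 <= k < j.+1) y k * invcol k j.

Lemma invcol_gt k j : (j < k)%N -> invcol k j = 0.
Proof. by move=> jk; rewrite /invcol big_geq ?mulr0. Qed.

Lemma mx_app_genmean_invapp y : mx_app T (invapp y) =1 y.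
Proof.
pose z i := \sum_(0 <= k < i.+1) atilde_coef s t k i * (r k * y k).
pose w i j := (- v) ^+ (j - i) / u ^+ (j - i).+1 * z i.
have invE j : invapp y j = \sum_(0 <= i < j.+1) w i j.
  rewrite /invapp /w /z /invcol.
  under [RHS]eq_bigr do rewrite mulr_sumr.
  rewrite exchange_triangle; apply: eq_bigr => k _.
  rewrite mulrA mulr_sumr; apply: eq_bigr => i _.
  by ring.
have Bz j : u * invapp y j + v * shift (invapp y) j = z j.
  rewrite invE big_nat_recr//= /w subnn expr0 expr1 mulrDr addrAC.
  rewrite [X in _ + X](_ : _ = z j); last by field.
  rewrite -[RHS]add0r; congr (_ + _).
  case: j => [|j]; first by rewrite big_geq// !mulr0 addr0.
  rewrite /= invE !mulr_sumr -big_split big_nat_cond big1//= => i.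
  rewrite andbT ltnS => ij; rewrite /w subSn// 2!exprS.
  by field; rewrite hu expf_neq0.
move=> n; rewrite mx_app_genmean /Tterm.
under eq_bigr do rewrite Bz /z mulr_sumr.
rewrite exchange_triangle.
have coef k : (k < n.+1)%N -> \sum_(k <= j < n.+1)
    s (n - j)%N * t j / r n * (atilde_coef s t k j * (r k * y k)) =
    (n == k)%:R * (r k / r n * y k).
  move=> kn; rewrite -{1}[k]add0n big_addn subSn//.
  rewrite (_ : (n == k) = (n - k == 0)%N); last by apply/idP/idP => /eqP; lia.
  rewrite -Dseq_conv mulr_suml; apply: eq_big_nat => l _.
  rewrite /atilde_coef addnK [(l + k)%N]addnC subnDA.
  by field; rewrite hr ht.
rewrite (@eq_big_nat _ _ _ _ _ _ (fun k => (n == k)%:R * (r k / r n * y k))).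
  rewrite big_nat_recr//= big_nat_cond big1 => [|k]; last first.
    rewrite andbT => /andP[_ kn]; rewrite (_ : (n == k) = false) ?mul0r//.
    by apply/eqP; lia.
  by rewrite eqxx mulfV// !mul1r add0r.
by move=> k /andP[_ kn]; rewrite coef.
Qed.

(** A right inverse of an injective map is a left inverse. *)
Lemma invapp_mx_app_genmean x : invapp (mx_app T x) =1 x.
Proof. by apply: mx_app_genmean_inj; exact: mx_app_genmean_invapp. Qed.

Lemma invapp_delta k : invapp (fun j => (j == k)%:R) =1 invcol k.
Proof.
move=> j; rewrite /invapp; have [kj|jk] := leqP k j; last first.
  rewrite invcol_gt// big_nat_cond big1// => i; rewrite andbT => /andP[_ ij].
  by rewrite (_ : (i == k) = false) ?mul0r//; apply/eqP; lia.
rewrite (bigD1_seq k) ?iota_uniq ?mem_index_iota//= eqxx mul1r big1 ?addr0//.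
by move=> i /negPf ->; rewrite mul0r.
Qed.

(** Exhibits the partial sums of the row functional a as functionals of the
    coordinate y in l_1, the form in which uniform boundedness is applied. *)
Lemma sum_invapp (a y : nat -> K) J :
  \sum_(0 <= j < J) a j * invapp y j =
  \sum_(0 <= k < J) y k * \sum_(0 <= j < J) a j * invcol k j.
Proof.
under eq_bigr do rewrite /invapp mulr_sumr.
rewrite exchange_triangle; apply: eq_big_nat => k /andP[_ kJ].
rewrite [in RHS](big_cat_nat (n := k))/=; [|by []|exact: ltnW].
rewrite [X in _ * (X + _)]big_nat_cond [X in _ * (X + _)]big1 ?add0r.
  by rewrite mulr_sumr; apply: eq_bigr => j _; rewrite mulrCA.
by move=> j; rewrite andbT => /andP[_ jk]; rewrite invcol_gt// mulr0.
Qed.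

End Triangles.

(** * The entries of atilde as row values on the columns of the inverse *)

Section AtildeLimit.
Context (K : numFieldType).

(** A double limit in the sense of Pringsheim is also the iterated limit, as soon
    as the inner limits exist. *)
Lemma cvg_iterated (G : nat -> nat -> K) (g : nat -> K) (l : K) :
  (fun N : nat * nat => G N.1 N.2) @ filter_prod \oo \oo --> l ->
  (\forall i \near \oo, G i @ \oo --> g i) -> g @ \oo --> l.
Proof.
move=> Gl Gg; apply/cvgrPdist_lt => e e0.
have e20 : 0 < e / 2 by rewrite divr_gt0.
have /cvgrPdist_lt/(_ _ e20)[[P Q] /= [Poo Qoo] PQ] := Gl.
apply: filterS2 Poo Gg => i Pi Gg.
have /cvgrPdist_lt/(_ _ e20)/(filterI Qoo)/filter_ex[j [Qj gj]] := Gg.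
rewrite -(subrK (G i j) l) -addrA (splitr e) (le_lt_trans (ler_normD _ _))//.
by rewrite ltrD//; [exact: (PQ (i, j))|rewrite distrC].
Qed.

Lemma cvg_diag (G : nat * nat -> K) (l : K) :
  G @ filter_prod \oo \oo --> l -> (fun n => G (n, n)) @ \oo --> l.
Proof.
apply: cvg_comp => A [[P Q] /= [Poo Qoo] PQ].
by apply: filterS2 Poo Qoo => n Pn Qn; exact: PQ.
Qed.

Lemma cvg_sum_nat (m n : nat) (F : nat -> nat -> K) (l : nat -> K) :
  (forall i, (m <= i < n)%N -> F i @ \oo --> l i) ->
  (fun J => \sum_(m <= i < n) F i J) @ \oo --> \sum_(m <= i < n) l i.
Proof.
move=> Fl; rewrite big_nat_cond.
under eq_fun do rewrite big_nat_cond.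
by apply: cvg_big => [|i /andP[/Fl]//]; exact: add_continuous.
Qed.

(** The partial sums over j < J of the row on the k-th column of the inverse are
    sums over a triangle k <= i <= j < J.  Summing over j first gives for
    i >= k + 2 the square partial sums of the double series in [atilde_cvg], and
    for i = k and i = k + 1 single series, from which the term i = j = k is
    split off. *)
Lemma cvg_atilde (r s t : nat -> K) (u v : K) A n k :
  atilde_cvg s t u v A n k ->
  (fun J => \sum_(0 <= j < J) A n j * invcol s r t u v k j) @ \oo -->
  atilde r s t u v A n k.
Proof.
move=> [near_cvg far_cvg /cvg_ex[/= l dbl_cvg]].
pose c := atilde_coef s t k; pose e := atilde_term u v A n.
have far : (fun N => \sum_(k.+2 <= i < N) c i *
    limn (fun J => \sum_(i <= j < J) e i j)) @ \oo --> l.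
  apply: cvg_iterated dbl_cvg _; apply: nearW => N /=.
  apply: cvg_sum_nat => i /andP[ki _]; apply: cvgZr.
  exact: far_cvg.
rewrite /atilde -[X in _ * (_ + X)]/(limn _) (cvg_lim _ far)//.
have split_sum : \forall J \near \oo,
    r k * (A n k / (s 0%N * t k) * u^-1
      + \sum_(k <= i < k.+2) c i * \sum_(k.+1 <= j < J) e i j
      + \sum_(k.+2 <= i < J) c i * \sum_(i <= j < J) e i j) =
    \sum_(0 <= j < J) A n j * invcol s r t u v k j.
  near=> J.
  have kJ : (k.+2 <= J)%N by near: J; exists k.+2.
  have kJ1 : (k.+1 <= J)%N by exact: ltnW.
  have kJ0 : (k <= J)%N by exact: ltnW.
  rewrite [RHS](big_cat_nat (n := k))//= [X in _ = X + _]big_nat_cond.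
  rewrite [X in _ = X + _]big1 ?add0r => [|j]; last first.
    by rewrite andbT => jk; rewrite invcol_gt// mulr0.
  rewrite [RHS](_ : _ = r k *
      \sum_(k <= j < J) \sum_(k <= i < j.+1) c i * e i j); last first.
    rewrite mulr_sumr; apply: eq_bigr => j _; rewrite /invcol mulrCA.
    by congr (_ * _); rewrite mulr_sumr; apply: eq_bigr => i _; rewrite /c /e /atilde_term; ring.
  rewrite exchange_triangle; congr (_ * _).
  rewrite [RHS](big_cat_nat (n := k.+2))//=; last by rewrite !leqW.
  congr (_ + _); last by apply: eq_bigr => i _; rewrite mulr_sumr.
  have two F : \sum_(k <= i < k.+2) F i = F k + F k.+1 :> K.
    by rewrite big_ltn// big_nat1.
  rewrite !two.
  rewrite [X in _ = X + _]big_ltn// addrA -!mulr_sumr.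
  congr (_ + _ + _).
  rewrite /c /e /atilde_coef /atilde_term subnn /Dseq det_mx00 !expr0 !expr1.
  by rewrite invfM; ring.
apply: cvg_trans (near_eq_cvg split_sum) _.
apply: cvgZr; apply: cvgD; last exact: cvg_diag dbl_cvg.
apply: cvgD; first exact: cvg_cst.
apply: cvg_sum_nat => i /near_cvg; exact: cvgZr.
Unshelve. all: by end_near. Qed.

End AtildeLimit.

(** * Continuity of the row functionals *)

Lemma nneseries_leP (R : realType) (f : nat -> R) (m : nat) (M : R) :
  (forall n, 0 <= f n) ->
  (\sum_(m <= n <oo) (f n)%:E <= M%:E)%E <->
  (forall N, \sum_(m <= n < N) f n <= M).
Proof.
move=> f0; have f0E n : (0 <= (f n)%:E)%E by rewrite lee_fin.
split=> [fM N|fM].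
  rewrite -lee_fin -sumEFin (le_trans _ fM)//.
  by apply: nneseries_lim_ge => n _ _.
apply: lime_le; first by apply: is_cvg_nneseries => n _ _.
by apply: nearW => N; rewrite sumEFin lee_fin.
Qed.

Section Rows.
Context (R : realType) (K : numFieldType) (nrm : K -> R).
Context (emb : {rmorphism R -> K}) (mod : modulus nrm emb).

Lemma nrm_lim_le (f : nat -> K) (z : K) (M : R) :
  f @ \oo --> z -> (\forall n \near \oo, nrm (f n) <= M) -> nrm z <= M.
Proof.
move=> fz fM; apply/ler_addgt0Pr => e e0.
have [n [fnM nze]] := filter_ex (filterI fM ((cvg_nrmP mod _ _ _).1 fz e e0)).
by rewrite -(subrK (f n) z) addrC (le_trans (nrmD mod _ _))// lerD// ltW.
Qed.

Lemma cvg_nrm_bounded (f : nat -> K) (z : K) :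
  f @ \oo --> z -> exists b, forall n, nrm (f n) <= b.
Proof.
move=> fz; have [N _ fN] := (cvg_nrmP mod _ _ _).1 fz 1 ltr01.
exists (nrm z + 1 + \sum_(0 <= i < N) nrm (f i)) => n.
have sum_ge0 : 0 <= \sum_(0 <= i < N) nrm (f i).
  by apply: sumr_ge0 => i _; exact: nrm_ge0 mod _.
have [Nn|nN] := leqP N n.
  rewrite (@le_trans _ _ (nrm z + 1)) ?lerDl//.
  rewrite -[f n](subrKC z) (le_trans (nrmD mod _ _))// lerD//.
  by rewrite (nrmB mod) ltW//; exact: fN.
rewrite (bigD1_seq n) ?iota_uniq ?mem_index_iota//= addrA addrAC lerDr.
rewrite addr_ge0 ?ler01 ?addr_ge0 ?(nrm_ge0 mod)//.
by apply: sumr_ge0 => i _; exact: nrm_ge0 mod _.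
Qed.

Lemma l1P (y : nat -> K) :
  lp_space nrm 1 y <-> exists M, forall N, \sum_(0 <= k < N) nrm (y k) <= M.
Proof.
have n0 k : 0 <= nrm (y k) by exact: nrm_ge0 mod _.
rewrite /lp_space /=; under eq_eseriesr do rewrite powRr1//.
split=> [|[M]]; last first.
  by move=> /(nneseries_leP _ _ n0) yM; exact: le_lt_trans yM (ltry _).
move=> yoo; exists (fine (\sum_(0 <= k <oo) (nrm (y k))%:E)%E).
apply/(nneseries_leP _ _ n0); rewrite fineK//.
by rewrite ge0_fin_numE// nneseries_ge0// => k _ _; rewrite lee_fin.
Qed.

Lemma l1_tail (y : nat -> K) (e : R) : lp_space nrm 1 y -> 0 < e ->
  \forall N \near \oo, forall J, \sum_(N <= k < J) nrm (y k) <= e.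
Proof.
have n0 k : 0 <= nrm (y k) by exact: nrm_ge0 mod _.
rewrite /lp_space /=; under eq_eseriesr do rewrite powRr1//.
move=> /nneseries_tail_cvg tail0 e0.
have /tail0/fine_cvgP[fin]: forall k, true -> (0 <= (nrm (y k))%:E)%E.
  by move=> k _; rewrite lee_fin.
move=> /cvgrPdist_lt/(_ e e0); apply: filterS2 fin => N fin.
rewrite sub0r normrN => /ltW tail_le; apply/(nneseries_leP _ _ n0).
rewrite -(fineK fin) lee_fin (le_trans _ tail_le)//.
exact: ler_norm.
Qed.

Section GlidingHump.
Context (c : nat -> nat -> K).
Context (c_tri : forall J k, (J <= k)%N -> c J k = 0).

(** Uniform boundedness for the functionals y |-> sum_(k < J) y_k c_Jk on l_1.
    Otherwise one chooses successively indices k_0 < J_1 <= k_1 < J_2 <= ... such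
    that c at (J_(n+1), k_n) is huge, and puts y_(k_n) = 2^-n.  In the functional
    of index J_(n+1) the later terms vanish because c is triangular, and the
    earlier ones are controlled by the column bounds b, which are known before
    k_n is chosen; so its value at y is at least n. *)
Lemma gliding_hump :
  (forall k, exists b, forall J, nrm (c J k) <= b) ->
  (forall y, lp_space nrm 1 y ->
    exists b, forall J, nrm (\sum_(0 <= k < J) y k * c J k) <= b) ->
  exists C, forall J k, nrm (c J k) <= C.
Proof.
move=> /choice[b cb] yb; apply: contrapT => unbounded.
have b0 k : 0 <= b k by rewrite (le_trans _ (cb k 0%N))// (nrm_ge0 mod).
(* the columns of index below m are bounded, so large entries occur beyond *)
have big C m : exists Jk : nat * nat,
    [/\ (m <= Jk.2)%N, (Jk.2 < Jk.1)%N & C < nrm (c Jk.1 Jk.2)].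
  apply: contrapT => nobig; apply: unbounded.
  exists (`|C| + \sum_(0 <= i < m) b i) => J k.
  have sum0 : 0 <= \sum_(0 <= i < m) b i by apply: sumr_ge0.
  have [mk|km] := leqP m k.
    have [kJ|Jk] := ltnP k J; last by rewrite c_tri// (nrm0 mod) addr_ge0.
    rewrite leNgt; apply/negP => Cc; apply: nobig; exists (J, k); split => //=.
    by rewrite (le_lt_trans _ Cc)// (le_trans (ler_norm _))// lerDl.
  rewrite (le_trans (cb k J))// (bigD1_seq k) ?iota_uniq ?mem_index_iota//=.
  by rewrite addrCA lerDl addr_ge0// sumr_ge0.
(* m n plays the role of J_n; the factor 2 ^ n compensates for y (k n) *)
pose need n m := 2 ^+ n * (n%:R + \sum_(0 <= i < m) b i).
pose pick n m := projT1 (cid (big (need n m) m)).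
have pickP n m : [/\ (m <= (pick n m).2)%N, ((pick n m).2 < (pick n m).1)%N &
    need n m < nrm (c (pick n m).1 (pick n m).2)].
  by rewrite /pick; case: cid.
pose m := fix m n := if n is n'.+1 then (pick n' (m n')).1 else 0%N.
pose k n := (pick n (m n)).2.
have mk n : (m n <= k n)%N by have [] := pickP n (m n).
have km n : (k n < m n.+1)%N by have [] := pickP n (m n).
have ck n : need n (m n) < nrm (c (m n.+1) (k n)) by have [] := pickP n (m n).
have m_mono : {homo m : i j / (i <= j)%N}.
  apply: homo_leq => // [i j l|i]; first exact: leq_trans.
  exact: leq_trans (mk i) (ltnW (km i)).
have block n j : (m n <= k j < m n.+1)%N -> j = n.
  move=> /andP[nj jn]; apply/eqP; rewrite eqn_leq; apply/andP; split.
    rewrite leqNgt; apply/negP => /m_mono; have := mk j; lia.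
  rewrite leqNgt; apply/negP => /m_mono; have := km j; lia.
pose y i := if pselect (exists n, k n = i) is left ex
            then emb (2 ^- projT1 (cid ex)) else 0.
have yk n : y (k n) = emb (2 ^- n).
  rewrite /y; case: pselect => [ex|]; last by case; exists n.
  case: cid => j /= kjn; congr (emb (2 ^- _)).
  by apply: block; rewrite kjn mk km.
have y0 n i : (m n <= i < m n.+1)%N -> i != k n -> y i = 0.
  move=> mim /eqP ik; rewrite /y; case: pselect => // ex; exfalso; apply: ik.
  by case: ex => j kj; move: mim; rewrite -kj => /block ->.
have nyk n : nrm (y (k n)) = 2 ^- n.
  by rewrite yk (nrm_emb mod) ger0_norm// invr_ge0 exprn_ge0.
have block_sum (F : nat -> K) n :
    \sum_(m n <= i < m n.+1) y i * F i = y (k n) * F (k n).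
  rewrite (bigD1_seq (k n)) ?iota_uniq ?mem_index_iota ?mk ?km//=.
  rewrite big_nat_cond big1 ?addr0// => i /andP[/y0 yi /yi ->].
  by rewrite mul0r.
have block_nrm n : \sum_(m n <= i < m n.+1) nrm (y i) = 2 ^- n.
  rewrite (bigD1_seq (k n)) ?iota_uniq ?mem_index_iota ?mk ?km//= nyk.
  rewrite big_nat_cond big1 ?addr0// => i /andP[/y0 yi /yi ->].
  exact: nrm0 mod.
have sum_nrm n : \sum_(0 <= i < m n) nrm (y i) <= 2 - 2 * 2 ^- n.
  elim: n => [|n IH]; first by rewrite big_geq// expr0 invr1; lra.
  rewrite (big_cat_nat (n := m n))//=; last exact: m_mono (leqnSn n).
  rewrite block_nrm exprS invfM.
  move: IH; lra.
have m_ge n : (n <= m n)%N by elim: n => // n IH; have := mk n; have := km n; lia.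
have yl1 : lp_space nrm 1 y.
  apply/l1P; exists 2 => N; rewrite (@le_trans _ _ (\sum_(0 <= i < m N) nrm (y i)))//.
    rewrite [leRHS](big_cat_nat (n := N))//= ?lerDl ?m_ge//.
    by rewrite sumr_ge0// => i _; exact: nrm_ge0 mod _.
  have e0 : 0 < 2 ^- N :> R by rewrite invr_gt0 exprn_gt0.
  by move: (sum_nrm N) e0; lra.
have [B yB] := yb y yl1.
have [n Bn] : exists n : nat, B < n%:R.
  by exists (Num.truncn B).+1; rewrite truncnS_gt.
have := yB (m n.+1); apply/negP; rewrite -ltNge (lt_le_trans Bn)//.
rewrite (big_cat_nat (n := m n))//=; last exact: m_mono (leqnSn n).
rewrite block_sum.
set head := \sum_(0 <= i < m n) _.
have head_le : nrm head <= \sum_(0 <= i < m n) b i.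
  rewrite (le_trans (nrm_sum mod _ _ _))//; apply: ler_sum => i _.
  rewrite (nrmM mod) (le_trans _ (cb i (m n.+1)))// ler_piMl ?(nrm_ge0 mod)//.
  have [[j <-]|nex] := pselect (exists j, k j = i).
    by rewrite nyk invf_le1 ?exprn_ege1 ?exprn_gt0 ?ler1n.
  by rewrite /y; case: pselect => // _; rewrite (nrm0 mod).
have hump : n%:R + \sum_(0 <= i < m n) b i <= nrm (y (k n) * c (m n.+1) (k n)).
  rewrite (nrmM mod) nyk ler_pdivlMl ?exprn_gt0//.
  exact/ltW/ck.
have := nrmD mod (head + y (k n) * c (m n.+1) (k n)) (- head).
rewrite addrAC subrr add0r (nrmN mod); move: head_le hump; lra.
Qed.

Context (a : nat -> K) (ca : forall k, (fun J => c J k) @ \oo --> a k).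
Context (C : R) (cC : forall J k, nrm (c J k) <= C).

Lemma dual_le (y : nat -> K) (z : K) (M : R) :
  (fun J => \sum_(0 <= k < J) y k * c J k) @ \oo --> z ->
  (forall N, \sum_(0 <= k < N) nrm (y k) <= M) -> nrm z <= C * M.
Proof.
move=> yz yM; apply: (nrm_lim_le yz); apply: nearW => J.
rewrite (le_trans (nrm_sum mod _ _ _))//.
have C0 : 0 <= C by rewrite (le_trans _ (cC 0 0))// (nrm_ge0 mod).
rewrite (@le_trans _ _ (C * \sum_(0 <= k < J) nrm (y k)))//; last first.
  exact: ler_wpM2l.
rewrite mulr_sumr; apply: ler_sum => k _.
by rewrite (nrmM mod) mulrC ler_wpM2r// (nrm_ge0 mod).
Qed.

(** Beyond N the partial functionals are bounded by C times the l_1-tail of y,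
    uniformly in J, and the finite part converges columnwise. *)
Lemma dual_expansion (y : nat -> K) (z : K) :
  lp_space nrm 1 y ->
  (fun J => \sum_(0 <= k < J) y k * c J k) @ \oo --> z ->
  (fun N => \sum_(0 <= k < N) y k * a k) @ \oo --> z.
Proof.
move=> yl1 yz; apply/(cvg_nrmP mod) => e e0.
have C0 : 0 <= C by rewrite (le_trans _ (cC 0 0))// (nrm_ge0 mod).
have C10 : 0 < C + 1 by rewrite ltr_wpDl.
have := l1_tail yl1 (divr_gt0 e0 C10); apply: filterS => N tailN.
apply: (@le_lt_trans _ _ (C * (e / (C + 1)))); last first.
  by rewrite mulrA ltr_pdivrMr// mulrC ltr_pM2l// ltrDl.
apply: (@nrm_lim_le (fun J => \sum_(0 <= k < J) y k * c J k -
    \sum_(0 <= k < N) y k * c J k)).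
  by apply: cvgB => //; apply: cvg_sum_nat => k _; exact: cvgZr.
near=> J.
have NJ : (N <= J)%N by near: J; exists N.
rewrite (big_cat_nat (n := N))//= addrAC subrr add0r.
rewrite (le_trans (nrm_sum mod _ _ _))//.
rewrite (@le_trans _ _ (C * \sum_(N <= k < J) nrm (y k)))//; last first.
  exact: ler_wpM2l.
rewrite mulr_sumr; apply: ler_sum => k _.
by rewrite (nrmM mod) mulrC ler_wpM2r// (nrm_ge0 mod).
Unshelve. all: by end_near. Qed.

End GlidingHump.
End Rows.

(** * The norm of l_p, heads and tails of sequences *)

Lemma le_poweR (R : realType) (q : R) (x y : \bar R) :
  0 <= q -> (0 <= x)%E -> (x <= y)%E -> (x `^ q <= y `^ q)%E.
Proof.
move=> q0 x0 xy; apply: gt0_ler_poweR => //; rewrite in_itv/= leey andbT//.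
exact: le_trans xy.
Qed.

Section LpNorm.
Context (R : realType) (K : numFieldType) (nrm : K -> R).
Context (emb : {rmorphism R -> K}) (mod : modulus nrm emb).
Context (p : R) (hp : 1 <= p).
Implicit Types (x y : nat -> K) (M : R).

Local Notation N_p := (lp_norm nrm p).

Let p_gt0 : 0 < p. Proof. exact: lt_le_trans hp. Qed.
Let p_neq0 : p != 0. Proof. by rewrite gt_eqF. Qed.

Let pow_ge0E x n : (0 <= (nrm (x n) `^ p)%:E)%E.
Proof. by rewrite lee_fin powR_ge0. Qed.

Lemma lp_norm_ge0 x : (0 <= N_p x)%E.
Proof. exact: poweR_ge0. Qed.

Lemma lp_norm_leP x M : 0 <= M ->
  (N_p x <= M%:E)%E <-> forall N, \sum_(0 <= n < N) nrm (x n) `^ p <= M `^ p.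
Proof.
move=> M0; have nn n : 0 <= nrm (x n) `^ p by exact: powR_ge0.
rewrite -(nneseries_leP _ _ nn) /lp_norm; set S := (\sum_(0 <= n <oo) _)%E.
have S0 : (0 <= S)%E by apply: nneseries_ge0 => n _ _; exact: pow_ge0E.
split=> [SM|SM].
  rewrite -[S]poweRe1// -(mulVf p_neq0) poweRrM -poweR_EFin.
  by apply: le_poweR => //; [exact: ltW|exact: poweR_ge0].
rewrite -[M%:E]poweRe1 ?lee_fin// -(mulfV p_neq0) poweRrM poweR_EFin.
by apply: le_poweR => //; rewrite invr_ge0 ltW.
Qed.

(** Minkowski's inequality for the counting measure. *)
Lemma lp_normD x y : (N_p (fun n => x n + y n)%R <= N_p x + N_p y)%E.
Proof.
have LE (f : nat -> R) : (forall n, 0 <= f n) ->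
    ('N[counting]_p%:E [EFin \o f] =
     (\sum_(0 <= n <oo) (f n `^ p)%:E) `^ p^-1)%E.
  move=> f0; rewrite Lnorm_counting//; congr (_ `^ _)%E.
  by apply: eq_eseriesr => n _ /=; rewrite ger0_norm// poweR_EFin.
have n0 z n : 0 <= nrm (z n) by exact: nrm_ge0 mod _.
have mf (f : nat -> R) : measurable_fun [set: nat] f by move=> _ Y _.
have := minkowski_EFin counting (mf (nrm \o x)) (mf (nrm \o y)) hp.
rewrite !LE//; [|by move=> n; exact: n0..|by move=> n /=; rewrite addr_ge0 ?n0].
apply: le_trans.
apply: le_poweR; first by rewrite invr_ge0 ltW.
  by apply: nneseries_ge0 => n _ _; rewrite lee_fin powR_ge0.
apply: lee_nneseries => n _; first by rewrite lee_fin powR_ge0.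
rewrite lee_fin; apply: (ge0_ler_powR (ltW p_gt0)).
- by rewrite nnegrE; exact: n0.
- by rewrite nnegrE addr_ge0 ?n0.
exact: nrmD mod _ _.
Qed.

Lemma lp_norm_le x y : (forall n, nrm (x n) <= nrm (y n)) -> (N_p x <= N_p y)%E.
Proof.
move=> xy; apply: le_poweR; first by rewrite invr_ge0 ltW.
  by apply: nneseries_ge0 => n _ _; exact: pow_ge0E.
apply: lee_nneseries => n _; first by move=> _; exact: pow_ge0E.
by rewrite lee_fin ge0_ler_powR// ?nnegrE ?(nrm_ge0 mod)// ltW.
Qed.

Lemma lp_dist_sym x y : lp_dist nrm p x y = lp_dist nrm p y x.
Proof.
rewrite /lp_dist; apply/eqP; rewrite eq_le.
by apply/andP; split; apply: lp_norm_le => n; rewrite (nrmB mod).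
Qed.

Lemma lp_normZ_le (a : K) x M : 0 <= M -> (N_p x <= M%:E)%E ->
  (N_p (fun n => a * x n)%R <= (nrm a * M)%:E)%E.
Proof.
move=> M0 /(lp_norm_leP _ M0) xM.
apply/lp_norm_leP; first by rewrite mulr_ge0// (nrm_ge0 mod).
move=> N; rewrite powRM ?(nrm_ge0 mod)//.
under eq_bigr do rewrite (nrmM mod) powRM ?(nrm_ge0 mod)//.
by rewrite -mulr_sumr ler_wpM2l ?powR_ge0.
Qed.

Lemma lp_norm0 : N_p (fun=> 0) = 0%E.
Proof.
apply/eqP; rewrite eq_le lp_norm_ge0 andbT.
apply/(lp_norm_leP _ (lexx 0)) => N.
by rewrite big1 ?powR_ge0// => n _; rewrite (nrm0 mod) powR0.
Qed.

Lemma lp_norm_comb_le (y : nat -> K) (e : nat -> nat -> K) M N : 0 <= M ->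
  (forall k, (N_p (e k) <= M%:E)%E) ->
  (N_p (fun n => \sum_(0 <= k < N) y k * e k n)%R <=
    ((\sum_(0 <= k < N) nrm (y k)) * M)%:E)%E.
Proof.
move=> M0 eM; elim: N => [|N IH].
  rewrite [X in N_p X](_ : _ = fun=> 0) ?lp_norm0 ?big_geq ?mul0r//.
  by apply/funext => n; rewrite big_geq.
under eq_fun do rewrite big_nat_recr//=.
rewrite big_nat_recr//= mulrDl EFinD (le_trans (lp_normD _ _))// leeD//.
exact: lp_normZ_le.
Qed.

Definition head_part (N : nat) x n := if (n < N)%N then x n else 0.

Lemma lp_norm_head_le x N :
  (N_p (head_part N x) <= (\sum_(0 <= n < N) nrm (x n))%:E)%E.
Proof.
pose delta (k n : nat) : K := (n == k)%:R.
have -> : head_part N x = fun n => \sum_(0 <= k < N) x k * delta k n.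
  apply/funext => n; rewrite /head_part; case: ltnP => [nN|Nn].
    rewrite (bigD1_seq n) ?iota_uniq ?mem_index_iota//= /delta eqxx mulr1.
    by rewrite big1 ?addr0// => k kn; rewrite eq_sym (negPf kn) mulr0.
  rewrite big_nat_cond big1// => k /andP[/andP[_ kN] _].
  by rewrite /delta (_ : (n == k) = false) ?mulr0//; apply/eqP; lia.
rewrite -[X in (_ <= X%:E)%E]mulr1; apply: lp_norm_comb_le => // k.
apply/lp_norm_leP => // J; rewrite powR1.
have [kJ|Jk] := ltnP k J.
  rewrite (bigD1_seq k) ?iota_uniq ?mem_index_iota//= /delta eqxx (nrm1 mod) powR1.
  by rewrite big1 ?addr0// => n /negPf ->; rewrite (nrm0 mod) powR0.
rewrite big_nat_cond big1// => n /andP[/andP[_ nJ] _].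
rewrite /delta (_ : (n == k) = false) ?(nrm0 mod) ?powR0//; apply/eqP; lia.
Qed.

(** Lower semicontinuity under coordinatewise convergence.  On finitely many
    coordinates the error is dominated by the l_1-norm, a finite sum tending
    to 0. *)
Lemma lp_norm_lim_le (f : nat -> nat -> K) x M : 0 <= M ->
  (forall n, f ^~ n @ \oo --> x n) -> (forall N, (N_p (f N) <= M%:E)%E) ->
  (N_p x <= M%:E)%E.
Proof.
move=> M0 fx fM.
have headM J : (N_p (head_part J x) <= M%:E)%E.
  apply/lee_addgt0Pr => e e0.
  have err0 : (fun N => \sum_(0 <= n < J) nrm (x n - f N n)) @ \oo --> (0 : R).
    have := @cvg_sum_nat R 0 J (fun n N => nrm (x n - f N n)) (fun=> 0).
    rewrite [X in _ --> X]big1//; apply => n _.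
    rewrite -(nrm0 mod) -[X in nrm X](subrr (x n)).
    by apply: (cvg_nrm mod); apply: cvgB => //; exact: cvg_cst.
  have /cvgrPdist_lt/(_ e e0)/filter_ex[N] := err0.
  rewrite sub0r normrN => /ltW/(le_trans (ler_norm _)) err_le.
  have -> : head_part J x =
      fun n => head_part J (f N) n + head_part J (fun n => x n - f N n) n.
    apply/funext => n; rewrite /head_part; case: ifP => _; first by rewrite subrKC.
    by rewrite addr0.
  rewrite (le_trans (lp_normD _ _))// leeD//; last first.
    by rewrite (le_trans (lp_norm_head_le _ _)) ?lee_fin.
  rewrite (le_trans _ (fM N))// lp_norm_le// => n; rewrite /head_part.
  by case: ifP => // _; rewrite (nrm0 mod) (nrm_ge0 mod).
apply/(lp_norm_leP _ M0) => J.
have := (lp_norm_leP _ M0).1 (headM J) J.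
apply: le_trans; rewrite le_eqVlt; apply/orP; left; apply/eqP.
by apply: eq_big_nat => n /andP[_ nJ]; rewrite /head_part nJ.
Qed.

(* tails *)
Definition tail_part (m : nat) x n := if (n <= m)%N then 0 else x n.

Lemma lp_norm_tail x m :
  N_p (tail_part m x) = ((\sum_(m.+1 <= n <oo) (nrm (x n) `^ p)%:E) `^ p^-1)%E.
Proof.
rewrite /lp_norm (nneseries_split 0 m.+1) => [|n _]; last exact: pow_ge0E.
rewrite add0n big_nat_cond big1 ?add0e => [|n /andP[/andP[_ nm] _]]; last first.
  by rewrite /tail_part -ltnS nm (nrm0 mod) powR0.
congr (limn _ `^ _)%E; apply/funext => N; apply: eq_big_nat => n /andP[mn _].
by rewrite /tail_part leqNgt mn.
Qed.

Lemma tailB m x y : tail_part m (fun n => x n - y n) = fun n => tail_part m x n - tail_part m y n.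
Proof. by apply/funext => n; rewrite /tail_part; case: ifP => _; rewrite ?subr0. Qed.

Lemma head_tail m x : x = fun n => head_part m.+1 x n + tail_part m x n.
Proof.
by apply/funext => n; rewrite /head_part /tail_part ltnS; case: ifP => _; rewrite ?addr0 ?add0r.
Qed.

Lemma lp_norm_tail_le m x : (N_p (tail_part m x) <= N_p x)%E.
Proof.
apply: lp_norm_le => n; rewrite /tail_part; case: ifP => // _.
by rewrite (nrm0 mod) (nrm_ge0 mod).
Qed.

Lemma lp_norm_tail_nonincreasing x :
  {homo (fun m => N_p (tail_part m x)) : m n / (m <= n)%N >-> (n <= m)%E}.
Proof.
move=> m n mn; apply: lp_norm_le => i; rewrite /tail_part.
case: ifP => [_|/negbT]; first by rewrite (nrm0 mod) (nrm_ge0 mod).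
by rewrite -ltnNge => ni; rewrite ifF//; apply/negbTE; lia.
Qed.

Lemma lp_norm_tail_small x (e : R) : lp_space nrm p x -> 0 < e ->
  exists m, (N_p (tail_part m x) <= e%:E)%E.
Proof.
move=> /nneseries_tail_cvg tail0 e0.
have /tail0/fine_cvgP[fin] : forall k, true -> (0 <= (nrm (x k) `^ p)%:E)%E.
  by move=> k _; exact: pow_ge0E.
move=> /cvgrPdist_lt/(_ (e `^ p)); rewrite powR_gt0// => /(_ isT) small.
have [m [finm]] := filter_ex
  (filterI (@nbhs_infty_ge 1) (filterI fin small)).
case: m finm => // m _ [finm]; rewrite sub0r normrN => /ltW sm.
exists m; rewrite lp_norm_tail -(fineK finm) poweR_EFin lee_fin.
rewrite -[leRHS]powRr1 ?(ltW e0)// -(mulfV p_neq0) powRrM.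
apply: ge0_ler_powR; rewrite ?nnegrE ?powR_ge0 ?invr_ge0 ?(ltW p_gt0)//.
  by apply: fine_ge0; apply: nneseries_ge0 => n _ _; exact: pow_ge0E.
exact: le_trans (ler_norm _) sm.
Qed.

Lemma lp_spaceP x : lp_space nrm p x <-> (N_p x < +oo)%E.
Proof.
split; first exact: poweR_lty.
by apply: lty_poweRy; rewrite invr_neq0.
Qed.

End LpNorm.

(** * The Hausdorff measure of noncompactness in l_p *)

Section HausdorffLp.
Context (R : realType) (K : numFieldType) (nrm : K -> R).
Context (emb : {rmorphism R -> K}) (mod : modulus nrm emb).
Context (p : R) (hp : 1 <= p).
Implicit Types (x z : nat -> K).

Local Notation N_p := (lp_norm nrm p).

(** A product of finitely many totally bounded sets is totally bounded; a point of
    the net is a list of m coordinates. *)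
Lemma finite_net_head (C : nat -> R) m (e : R) : 0 < e ->
  exists l : seq (seq K), forall z, (forall n, nrm (z n) <= C n) ->
    exists2 w, w \in l &
      size w = m /\ \sum_(0 <= n < m) nrm (z n - w`_n) <= e.
Proof.
elim: m e => [|m IH] e e0.
  exists [:: [::]] => z _; exists [::]; first by rewrite mem_seq1.
  by rewrite big_geq// ltW.
have e20 : 0 < e / 2 by rewrite divr_gt0.
have [l hl] := IH _ e20; have [l' hl'] := finite_net mod (C m) e20.
exists [seq rcons w c | w <- l, c <- l'] => z zC.
have [w wl [sw we]] := hl z zC; have [c cl ce] := hl' _ (zC m).
exists (rcons w c); first by apply/allpairsP; exists (w, c).
split; first by rewrite size_rcons sw.
rewrite big_nat_recr//= nth_rcons sw ltnn eqxx [e]splitr lerD//.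
rewrite (le_trans _ we)// le_eqVlt; apply/orP; left; apply/eqP.
by apply: eq_big_nat => n /andP[_ nm]; rewrite nth_rcons sw nm.
Qed.

(** The tail suprema decrease with m, so their limit is their infimum.  Given a
    covering by balls of radii smaller than eps, one m makes the m-tail of each
    centre smaller than eps minus its radius, which bounds the m-tails of Q by
    eps.  Conversely, finitely supported sequences whose heads form a net for
    the heads of Q are centres of balls of radius slightly larger than the m-th
    supremum.  Q must be nonempty: the supremum over the empty set is -oo. *)
Lemma hausdorff_mnc_lp (Q : set (nat -> K)) :
  Q !=set0 -> Q `<=` lp_space nrm p ->
  (forall n, exists C, forall z, Q z -> nrm (z n) <= C) ->
  (fun m => ereal_sup [set N_p (tail_part m z) | z in Q]) @ \oo -->
  hausdorff_mnc (lp_space nrm p) (lp_dist nrm p) Q.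
Proof.
move=> [z0 Qz0] Qlp /choice[C QC].
set M := fun m => _.
have M_ge z m : Q z -> (N_p (tail_part m z) <= M m)%E.
  by move=> Qz; apply: ereal_sup_ubound; exists z.
have M_ni : nonincreasing_seq M.
  move=> m n mn; apply: ge_ereal_sup => _ [z Qz <-].
  by rewrite (le_trans _ (M_ge z m Qz))// (lp_norm_tail_nonincreasing mod hp).
suff -> : hausdorff_mnc (lp_space nrm p) (lp_dist nrm p) Q =
    ereal_inf (M @` setT) by exact: ereal_nonincreasing_cvgn.
apply/eqP; rewrite eq_le; apply/andP; split; last first.
  apply: le_ereal_inf_tmp => _ [eps [eps0 [n [c [rad [crad cover]]]]] <-].
  have gap i : 0 < eps - rad i by rewrite subr_gt0; exact: (crad i).2.
  have /choice[m tail_c] i : exists m, (N_p (tail_part m (c i)) <= (eps - rad i)%:E)%E.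
    by apply: (lp_norm_tail_small mod hp _ (gap i)); exact: (crad i).1.
  pose m' := \max_i m i.
  apply: (@le_trans _ _ (M m')); first by apply: ereal_inf_lbound; exists m'.
  apply: ge_ereal_sup => _ [z Qz <-].
  have [i _ /= [_ dist_lt]] := cover z Qz.
  have -> : tail_part m' z =
      fun n => tail_part m' (c i) n + tail_part m' (fun j => z j - c i j) n.
    by rewrite tailB; apply/funext => j; rewrite subrKC.
  rewrite (le_trans (lp_normD mod hp _ _))// -(subrK (rad i) eps) EFinD leeD//.
    apply: le_trans (tail_c i).
    by apply: (lp_norm_tail_nonincreasing mod hp) => //; exact: leq_bigmax.
  rewrite (le_trans (lp_norm_tail_le mod hp _ _))//.
  by rewrite -/(lp_dist nrm p z (c i)) (lp_dist_sym mod hp) ltW.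
apply: le_ereal_inf_tmp => _ [m _ <-].
have M0 : (0 <= M m)%E := le_trans (lp_norm_ge0 _ _ _) (M_ge z0 m Qz0).
have [->|Mfin] := eqVneq (M m) +oo%E; first by rewrite leey.
have : M m \is a fin_num by rewrite ge0_fin_numE// ltey.
move=> /fineK Mr; rewrite -Mr; set r := fine (M m) in Mr *.
have r0 : 0 <= r by rewrite -lee_fin Mr.
apply/lee_addgt0Pr => e e0; apply: ereal_inf_lbound.
exists (r + e); last by rewrite EFinD.
split; first by rewrite ltr_wpDl.
have e40 : 0 < e / 4 by rewrite divr_gt0.
have [l hl] := finite_net_head C m.+1 e40.
pose c i := head_part m.+1 (nth 0 (nth [::] l i)).
(* i = size l yields a harmless extra centre and keeps the index set nonempty *)
exists (size l), (fun i => c i), (fun=> r + e / 2); split=> [i|z Qz].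
  split; last by rewrite ltrD2l ltr_pdivrMr// ltr_pMr// ltr1n.
  apply/(lp_spaceP nrm hp).
  exact: le_lt_trans (lp_norm_head_le mod hp _ _) (ltry _).
have [w wl [sw we]] := hl z (fun n => QC n z Qz).
have wi : (index w l < (size l).+1)%N by rewrite ltnS index_size.
exists (Ordinal wi) => //=; split; first exact: Qlp.
rewrite (lp_dist_sym mod hp) /lp_dist /c nth_index//.
rewrite [X in N_p X](head_tail m).
apply: (le_lt_trans (lp_normD mod hp _ _)).
apply: (@le_lt_trans _ _ ((e / 4)%:E + r%:E)%E); last first.
  by rewrite -EFinD lte_fin; lra.
apply: leeD.
  rewrite (le_trans (lp_norm_head_le mod hp _ _))// lee_fin.
  rewrite (le_trans _ we)// le_eqVlt; apply/orP; left; apply/eqP.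
  by apply: eq_big_nat => n /andP[_ nm]; rewrite /head_part nm.
rewrite Mr; apply: le_trans (M_ge z m Qz); apply: (lp_norm_le mod hp) => n.
by rewrite /tail_part /head_part ltnS; case: ifP => // ->; rewrite subr0.
Qed.

End HausdorffLp.

(** * The image of the unit sphere *)

Section Main.
Context (R : realType) (K : numFieldType) (nrm : K -> R).
Context (emb : {rmorphism R -> K}) (mod : modulus nrm emb).
Context (r s t : nat -> K) (u v : K).
Context (hr : forall n, r n != 0) (ht : forall n, t n != 0) (hs : s 0%N != 0)
  (hu : u != 0).

Local Notation T := (genmean_diff_mx r s t u v).
Local Notation S := (invapp s r t u v).
Local Notation e_ := (invcol s r t u v).

Lemma mx_app_invapp y : mx_app T (S y) = y.
Proof. by apply/funext; exact: mx_app_genmean_invapp. Qed.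

Lemma invapp_mx_app x : S (mx_app T x) = x.
Proof. by apply/funext; exact: invapp_mx_app_genmean. Qed.

Lemma l1rst_invapp y : lp_space nrm 1 y -> l1rst nrm r s t u v (S y).
Proof.
move=> yl1; split; first exact: mx_app_genmean_defined.
by rewrite mx_app_invapp.
Qed.

Lemma sphere_invcol k : l1rst_sphere nrm r s t u v (e_ k).
Proof.
have -> : e_ k = S (fun j => (j == k)%:R).
  by apply/funext => j; rewrite invapp_delta.
have n1 : lp_norm nrm 1 (fun j => (j == k)%:R : K) = 1%:E.
  have S1 N : \sum_(0 <= j < N) nrm ((j == k)%:R) `^ 1 = (k < N)%:R.
    have [kN|Nk] := ltnP k N.
      rewrite (bigD1_seq k) ?iota_uniq ?mem_index_iota//= eqxx (nrm1 mod) powR1.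
      by rewrite big1 ?addr0// => j /negPf ->; rewrite (nrm0 mod) powR0 ?oner_eq0.
    rewrite big_nat_cond big1// => j /andP[/andP[_ jN] _].
    by rewrite (_ : (j == k) = false) ?(nrm0 mod) ?powR0 ?oner_eq0//; apply/eqP; lia.
  rewrite /lp_norm invr1 (_ : (\sum_(0 <= j <oo) _)%E = 1%:E) ?poweR1r//.
  apply: lim_near_cst => //; near=> N.
  have kN : (k < N)%N by near: N; exists k.+1.
  by rewrite sumEFin S1 kN.
split; last by rewrite /l1rst_norm mx_app_invapp.
by apply: l1rst_invapp; apply/(lp_spaceP nrm (lexx 1)); rewrite n1 ltry.
Unshelve. all: by end_near. Qed.

Context (p : R) (hp : 1 <= p) (A : nat -> nat -> K).
Context (hA : mx_class (l1rst nrm r s t u v) (lp_space nrm p) A).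
Context (hcvg : forall n k, atilde_cvg s t u v A n k).

Local Notation a := (atilde r s t u v A).
Let c n J k := \sum_(0 <= j < J) A n j * e_ k j.

Lemma mx_app_cvg y n : lp_space nrm 1 y ->
  (fun J => \sum_(0 <= k < J) y k * c n J k) @ \oo --> mx_app A (S y) n.
Proof.
move=> /l1rst_invapp/hA[/(_ n) cvgA _].
rewrite (_ : (fun J => _) = series (fun j => A n j * S y j)); first exact: cvgA.
by apply/funext => J; rewrite /series/= sum_invapp.
Qed.

Lemma mx_app_invcol k n : mx_app A (e_ k) n = a n k.
Proof. by apply: cvg_lim => //; exact: cvg_atilde. Qed.

Lemma rows_bounded n : exists C, forall J k, nrm (c n J k) <= C.
Proof.
apply: (gliding_hump mod) => [J k Jk|k|y yl1].
- rewrite /c big_nat_cond big1// => j /andP[/andP[_ jJ] _].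
  by rewrite invcol_gt ?mulr0// (leq_trans jJ).
- exact: (cvg_nrm_bounded mod (cvg_atilde (hcvg n k))).
- exact: (cvg_nrm_bounded mod (mx_app_cvg yl1)).
Qed.

Lemma sphereP x : l1rst_sphere nrm r s t u v x -> exists y,
  [/\ x = S y, lp_space nrm 1 y & forall N, \sum_(0 <= k < N) nrm (y k) <= 1].
Proof.
move=> [[_ yl1] y1]; exists (mx_app T x); split=> //.
  by rewrite invapp_mx_app.
move: y1; rewrite /l1rst_norm => y1 N.
have := (lp_norm_leP nrm (lexx 1) (mx_app T x) ler01).1.
rewrite y1 => /(_ (lexx _) N); rewrite powR1; apply: le_trans.
by rewrite le_eqVlt; apply/orP; left; apply/eqP; apply: eq_bigr => k _;
  rewrite powRr1// (nrm_ge0 mod).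
Qed.

Lemma image_coord_bounded n : exists C, forall z,
  (mx_app A @` l1rst_sphere nrm r s t u v) z -> nrm (z n) <= C.
Proof.
have [C cC] := rows_bounded n; exists (C * 1) => _ [x /sphereP[y [-> yl1 y1]] <-].
exact: (dual_le mod cC (mx_app_cvg yl1)).
Qed.

(** The tail of A x is the coordinatewise limit of combinations of the tails of
    the columns, with coefficients y_k of total modulus at most 1. *)
Lemma image_tail_le m (M : R) z : 0 <= M ->
  (forall k, (lp_norm nrm p (tail_part m (a ^~ k)) <= M%:E)%E) ->
  (mx_app A @` l1rst_sphere nrm r s t u v) z ->
  (lp_norm nrm p (tail_part m z) <= M%:E)%E.
Proof.
move=> M0 aM [x /sphereP[y [-> yl1 y1]] <-].
apply: (lp_norm_lim_le mod hp (f := fun N n =>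
  \sum_(0 <= k < N) y k * tail_part m (a ^~ k) n)) => // [n|N].
  rewrite /tail_part; case: ifP => _.
    under eq_fun do under eq_bigr do rewrite mulr0.
    by under eq_fun do rewrite big1//; exact: cvg_cst.
  have [C cC] := rows_bounded n.
  by apply: (dual_expansion mod _ cC yl1 (mx_app_cvg yl1)) => k; exact: cvg_atilde.
rewrite (le_trans (lp_norm_comb_le mod hp _ _ M0 aM))// lee_fin.
by rewrite ler_piMl.
Qed.

Lemma image_sup_tail m :
  ereal_sup [set lp_norm nrm p (tail_part m z) |
    z in mx_app A @` l1rst_sphere nrm r s t u v] =
  ereal_sup [set lp_norm nrm p (tail_part m (a ^~ k)) | k in [set: nat]].
Proof.
have aE k : a ^~ k = mx_app A (e_ k).
  by apply/funext => n; rewrite mx_app_invcol.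
apply/eqP; rewrite eq_le; apply/andP; split; last first.
  apply: ereal_sup_le => _ [k _ <-]; exists (a ^~ k) => //.
  by rewrite aE; exists (e_ k) => //; exact: sphere_invcol.
set M := (leRHS).
have aM k : (lp_norm nrm p (tail_part m (a ^~ k)) <= M)%E.
  by apply: ereal_sup_ubound; exists k.
have M0 : (0 <= M)%E := le_trans (lp_norm_ge0 _ _ _) (aM 0%N).
have [->|Mfin] := eqVneq M +oo%E; first by rewrite leey.
have : M \is a fin_num by rewrite ge0_fin_numE// ltey.
move=> /fineK Mr; apply: ge_ereal_sup => _ [z Qz <-].
rewrite -Mr; apply: image_tail_le Qz; first by rewrite -lee_fin Mr.
by move=> k; rewrite Mr.
Qed.

End Main.

Theorem theorem5p3 (R : realType) (K : numFieldType) (nrm : K -> R)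
    (HK : real_or_complex nrm)
    (r s t : nat -> K) (u v : K)
    (hr : forall n, r n != 0) (ht : forall n, t n != 0) (hs : s 0%N != 0)
    (hu : u != 0) (hv : v != 0)
    (p : R) (hp : 1 <= p)
    (A : nat -> nat -> K)
    (hA : mx_class (l1rst nrm r s t u v) (lp_space nrm p) A)
    (hcvg : forall n k, atilde_cvg s t u v A n k) :
  (fun m : nat =>
     ereal_sup [set ((\sum_(m.+1 <= n <oo)
                        (nrm (atilde r s t u v A n k) `^ p)%:E) `^ p^-1)%E
               | k in [set: nat]]) @ \oo -->
  op_mnc (l1rst_sphere nrm r s t u v) (lp_space nrm p) (lp_dist nrm p)
         (mx_app A).
Proof.
have [emb mod] := real_or_complex_modulus HK.
have := hausdorff_mnc_lp mod hp
  (Q := mx_app A @` l1rst_sphere nrm r s t u v).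
rewrite (_ : (fun m => ereal_sup [set lp_norm nrm p (tail_part m z) | z in _]) =
    fun m => ereal_sup [set ((\sum_(m.+1 <= n <oo)
      (nrm (atilde r s t u v A n k) `^ p)%:E) `^ p^-1)%E | k in [set: nat]]).
  apply.
  - by exists (mx_app A (invcol s r t u v 0)), (invcol s r t u v 0) => //;
      apply: (sphere_invcol mod) => //.
  - by move=> _ [x [xl1 _] <-]; exact: (hA x xl1).2.
  - exact (image_coord_bounded mod hr ht hs hu hA hcvg).
apply/funext => m.
rewrite (image_sup_tail mod hr ht hs hu hp hA hcvg).
by under eq_imagel do rewrite (lp_norm_tail mod hp).
Qed.
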